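(* Let $N\ge 847$ be an integer, and let $M$ be the set of pairs produced by the born-free matching algorithm with $p_{\max}=5$ for $N$. Then $\sum_{(x,y)\in M} y > \frac{1}{2}\cdot\frac{N(N+1)}{2}$, i.e., the sum of the larger elements of the pairs of $M$ exceeds half of $1+2+\dots+N$.
   Context: For a prime $p$ and a positive integer $N$, let $S_p=\{(x,px): x\in\mathbb{N},\ px\le N\}$. The born-free matching algorithm with $p_{\max}=5$ for $N$: start with $M=\emptyset$; run through the primes $5,3,2$ in this order (only those $\le N$); for each such $p$, run through the pairs $(x,px)\in S_p$ in descending order of $x$, and add $(x,px)$ to $M$ whenever neither $x$ nor $px$ is an endpoint of a pair already in $M$. *)

(* Defs.v *)
From mathcomp Require Import all_boot.
Set Implicit Arguments. Unset Strict Implicit. Unset Printing Implicit Defensive.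

Definition Sp_desc (p N : nat) : seq (nat * nat) :=
  [seq (x, p * x) | x <- rev (iota 1 (N %/ p))].

Definition endpoint (M : seq (nat * nat)) (z : nat) : bool :=
  has (fun e => (e.1 == z) || (e.2 == z)) M.

Definition greedy_step (M : seq (nat * nat)) (e : nat * nat) : seq (nat * nat) :=
  if ~~ endpoint M e.1 && ~~ endpoint M e.2 then rcons M e else M.

Definition born_free_order (N : nat) : seq (nat * nat) :=
  flatten [seq Sp_desc p N | p <- [:: 5; 3; 2] & p <= N].

Definition born_free_matching (N : nat) : seq (nat * nat) :=
  foldl greedy_step [::] (born_free_order N).

(* Main.v *)
Require Import Defs.
From mathcomp Require Import all_boot.
From mathcomp Require Import zify.

(** The pairs (x, 5x) with 5x > N/5, the pairs (x, 3x) with x > N/5 and x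
    prime to 5, and the pairs (x, 2x) with x > N/3 and x prime to 15 share no endpoint with any candidate
    examined before them, so the greedy algorithm selects all of them.  Their
    larger elements are the y <= N satisfying one of three conditions, each
    30-periodic above a threshold; together they sum to about 0.2554 N^2,
    and for N >= 847 the excess over N^2/4 absorbs the linear error terms. *)

Lemma greedy_subset (s M : seq (nat * nat)) e :
  e \in M -> e \in foldl greedy_step M s.
Proof.
elim: s M => //= f s IHs M eM; apply: IHs.
by rewrite /greedy_step; case: ifP => // _; rewrite mem_rcons inE eM orbT.
Qed.

Lemma endpoint_greedy (s M : seq (nat * nat)) z :
  endpoint (foldl greedy_step M s) z -> endpoint M z || endpoint s z.
Proof.
rewrite /endpoint; elim: s M => [|f s IHs] M /=; first by rewrite orbF.
move/IHs; rewrite /greedy_step; case: ifP => _.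
  by rewrite has_rcons orbCA orbA.
by case/orP => ->; rewrite ?orbT.
Qed.

(** Every endpoint of the running matching comes from a candidate already examined, and a chosen
    pair is never discarded, so freedom from all of [s1] suffices. *)
Lemma greedy_mem (s1 s2 : seq (nat * nat)) e :
  ~~ endpoint s1 e.1 -> ~~ endpoint s1 e.2 ->
  e \in foldl greedy_step [::] (s1 ++ e :: s2).
Proof.
move=> e1 e2; rewrite foldl_cat /=; apply: greedy_subset.
have free z : ~~ endpoint s1 z -> ~~ endpoint (foldl greedy_step [::] s1) z.
  by apply: contra => /endpoint_greedy.
by rewrite /greedy_step !free // mem_rcons mem_head.
Qed.

Lemma endpoint_multiples p (s : seq nat) z :
  endpoint [seq (x, p * x) | x <- s] z ->
  exists2 x, x \in s & z = x \/ z = p * x.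
Proof.
case/hasP => _ /mapP[x xs ->] /= /orP[] /eqP <-; exists x; by [|left|right].
Qed.

Lemma endpoint_Sp_desc p N z : 0 < p ->
  endpoint (Sp_desc p N) z -> p * z <= N \/ p %| z.
Proof.
move=> p_gt0 /endpoint_multiples[x]; rewrite mem_rev mem_iota => x_le.
case=> ->; last by right; apply: dvdn_mulr.
by left; rewrite mulnC -leq_divRL //; lia.
Qed.

Lemma Sp_desc_split p N x : 0 < x <= N %/ p ->
  Sp_desc p N = [seq (z, p * z) | z <- rev (iota x.+1 (N %/ p - x))]
    ++ (x, p * x) :: [seq (z, p * z) | z <- rev (iota 1 x.-1)].
Proof.
case: x => // x /= xn; rewrite /Sp_desc -{1}(subnKC xn) addSnnS iotaD rev_cat.
by rewrite add1n /= rev_cons map_cat map_rcons cat_rcons.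
Qed.

(** Within its own block, [(x, p * x)] is preceded only by pairs [(t, p * t)] with [x < t]. The one
    possible clash is [t = p * x], and [N < p * (p * x)] rules it out. *)
Lemma greedy_multiple_mem p N x (s1 s2 : seq (nat * nat)) :
  1 < p -> 0 < x -> p * x <= N -> N < p * (p * x) ->
  ~~ endpoint s1 x -> ~~ endpoint s1 (p * x) ->
  (x, p * x) \in foldl greedy_step [::] (s1 ++ Sp_desc p N ++ s2).
Proof.
move=> p_gt1 x_gt0 pxN Nppx s1x s1px.
have p_gt0 : 0 < p by lia.
have xb : x <= N %/ p by rewrite leq_divRL // mulnC.
rewrite (Sp_desc_split p N x) ?x_gt0 // -catA catA.
have later z : z = x \/ z = p * x ->
    ~~ endpoint [seq (z, p * z) | z <- rev (iota x.+1 (N %/ p - x))] z.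
  move=> zE; apply/negP => /endpoint_multiples[t].
  rewrite mem_rev mem_iota => tb zt.
  have pt : p * t <= N by rewrite mulnC -leq_divRL //; lia.
  by case: zE zt => -> [] E; nia.
by apply: greedy_mem; rewrite /endpoint has_cat negb_or ?s1x ?s1px;
  apply: later; [left | right].
Qed.

(** For [y = p * x], the three thresholds read [25 * x > N], [5 * x > N] and [3 * x > N]. *)
Definition top5 N y := (5 %| y) && (N < 5 * y).
Definition top3 N y := [&& 3 %| y, ~~ (5 %| y) & 3 * N < 5 * y].
Definition top2 N y := [&& 2 %| y, ~~ (3 %| y), ~~ (5 %| y) & 2 * N < 3 * y].

Lemma top_matched N y : 5 <= N -> 0 < y <= N ->
  [|| top5 N y, top3 N y | top2 N y] ->
  y \in [seq e.2 | e <- born_free_matching N].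
Proof.
move=> N5 yb Py.
have -> : born_free_matching N =
    foldl greedy_step [::] (Sp_desc 5 N ++ Sp_desc 3 N ++ Sp_desc 2 N).
  rewrite /born_free_matching /born_free_order /=.
  by rewrite N5 (ltnW (ltnW N5)) (ltnW (ltnW (ltnW N5))) /= cats0.
have free p z : 0 < p -> N < p * z -> ~~ (p %| z) ->
    ~~ endpoint (Sp_desc p N) z.
  by move=> p0 Nz pz; apply/negP => /(endpoint_Sp_desc _ _ _ p0); lia.
case/or3P: Py => [/andP[/dvdnP[x yx] Ny]|/and3P[/dvdnP[x yx] y5 Ny]|
    /and4P[/dvdnP[x yx] y3 y5 Ny]]; apply/mapP.
- exists (x, 5 * x); last by rewrite /= mulnC.
  by apply: (greedy_multiple_mem 5 N x [::]) => //; lia.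
- exists (x, 3 * x); last by rewrite /= mulnC.
  by apply: greedy_multiple_mem; rewrite ?free //; lia.
- exists (x, 2 * x); last by rewrite /= mulnC.
  rewrite catA -[X in _ ++ X]cats0.
  by apply: greedy_multiple_mem;
    rewrite /endpoint ?has_cat ?negb_or -?/(endpoint _ _) ?free //; lia.
Qed.

Definition wsum (c : pred nat) n := \sum_(0 <= y < n.+1 | c y) y.

Lemma wsum_tail (c : pred nat) a n : a <= n ->
  \sum_(0 <= y < n.+1 | c y && (a < y)) y + wsum c a = wsum c n.
Proof.
move=> an; rewrite /wsum (big_cat_nat (n := a.+1)) //=.
rewrite [RHS](big_cat_nat (n := a.+1)) //= addnC; congr addn.
rewrite big_nat_cond big1 ?add0n; last by move=> i; lia.
rewrite big_nat_cond [RHS]big_nat_cond; apply: eq_bigl => y.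
by case: (c y); lia.
Qed.

(** Shifting a block by [30 * t] adds [30 * t] per selected element; summing over [t < q] gives
    [q * (q - 1) / 2]. Doubling and moving the negative term to the left avoid division and
    subtraction. *)
Lemma wsum_period (c : pred nat) q r : (forall y, c (y + 30) = c y) ->
  2 * wsum c (30 * q + r) + 30 * q * count c (iota 0 30) =
  30 * q ^ 2 * count c (iota 0 30) + 2 * q * wsum c 29
  + 60 * q * count c (iota 0 r.+1) + 2 * wsum c r.
Proof.
move=> cP.
have cE t y : c (y + 30 * t) = c y.
  by elim: t => [|t <-]; rewrite ?addn0 // -[RHS]cP; congr c; lia.
have block t k : \sum_(30 * t <= y < 30 * t + k | c y) y =
    \sum_(0 <= y < k | c y) y + 30 * t * count c (iota 0 k).
  rewrite -{1}[30 * t]add0n [_ + k]addnC big_addn addnK.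
  under eq_bigl => y do rewrite cE.
  by rewrite big_split /= -sum1_count big_distrr /= /index_iota subn0 muln1.
have split t k : wsum c (30 * t + k) =
    \sum_(0 <= y < 30 * t | c y) y + wsum c k
    + 30 * t * count c (iota 0 k.+1).
  by rewrite /wsum -addnS (big_cat_nat (n := 30 * t)) ?leq_addr //= block addnA.
have base t : 2 * \sum_(0 <= y < 30 * t | c y) y
    + 30 * t * count c (iota 0 30)
    = 30 * t ^ 2 * count c (iota 0 30) + 2 * t * wsum c 29.
  elim: t => [|t IHt]; first by rewrite muln0 big_geq.
  have -> : 30 * t.+1 = (30 * t + 29).+1 by lia.
  by rewrite -/(wsum c _) split; nia.
by rewrite split; have := base q; lia.
Qed.

Lemma wsumE (c : pred nat) n : wsum c n = sumn [seq y <- iota 0 n.+1 | c y].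
Proof. by rewrite sumnE big_filter. Qed.

(* Writing n = 30q + r, the condition m * C 29 = 60 * s makes the q^2 terms
   cancel, so each bound is affine in q and is checked on its two coefficients
   for every residue r. *)
Lemma wsum_bounds (c : pred nat) m s l d u e :
  (forall y, c (y + 30) = c y) ->
  let C r := count c (iota 0 r.+1) in
  let W r := sumn [seq y <- iota 0 r.+1 | c y] in
  m * C 29 = 60 * s ->
  all (fun r => [&& 120 * s * r + 30 * m * C 29
                      <= 2 * m * W 29 + 60 * m * C r + 60 * l,
                    s * r ^ 2 <= m * W r + l * r + d,
                    2 * m * W 29 + 60 * m * C r
                      <= 120 * s * r + 30 * m * C 29 + 60 * u
                  & m * W r <= s * r ^ 2 + u * r + e]) (iota 0 30) ->
  forall n, s * n ^ 2 <= m * wsum c n + l * n + d /\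
            m * wsum c n <= s * n ^ 2 + u * n + e.
Proof.
move=> cP C W mC /allP chk n.
have r30 : n %% 30 \in iota 0 30 by rewrite mem_iota ltn_mod.
have /and4P[] := chk _ r30; move: (n %% 30) (n %/ 30) (divn_eq n 30) => r q ->.
rewrite [q * 30]mulnC; have := wsum_period c q r cP.
rewrite !(wsumE c r) (wsumE c 29) -/(W r) -/(W 29) -/(C r) -/(C 29).
move: (wsum _ _) (W r) (W 29) (C r) (C 29) mC => S Wr W29 Cr C29 mC.
(* Multiplied by [q], the bounds on the linear coefficients combine linearly with [E] and the
   constant bounds. *)
move=> /(congr1 (muln m)) E /(leq_mul (leqnn q)) l1 l2 /(leq_mul (leqnn q)) u1 u2.
have mCq : m * C29 * q ^ 2 = 60 * s * q ^ 2 by rewrite mC.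
split; nia.
Qed.

(** These are the periodic parts of [top5], [top3], [top2]. Their densities 1/5, 4/15, 4/15, halved,
    are the leading coefficients in the bounds below. *)
Definition mult5 y := 5 %| y.
Definition mult3 y := (3 %| y) && ~~ (5 %| y).
Definition mult2 y := [&& 2 %| y, ~~ (3 %| y) & ~~ (5 %| y)].

Lemma mult5_bounds n : n ^ 2 <= 10 * wsum mult5 n + 3 * n + 4 /\
  10 * wsum mult5 n <= n ^ 2 + 5 * n.
Proof.
rewrite -{1}[n ^ 2]mul1n -[n ^ 2 in X in _ /\ X]mul1n -[1 * n ^ 2 + 5 * n]addn0.
by apply: wsum_bounds; [move=> y; rewrite /mult5 !dvdn_addl | vm_compute | vm_compute].
Qed.

Lemma mult3_bounds n : 2 * n ^ 2 <= 15 * wsum mult3 n + 8 * n + 8 /\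
  15 * wsum mult3 n <= 2 * n ^ 2 + 12 * n + 20.
Proof.
by apply: wsum_bounds; [move=> y; rewrite /mult3 !dvdn_addl | vm_compute | vm_compute].
Qed.

Lemma mult2_bounds n : 2 * n ^ 2 <= 15 * wsum mult2 n + 10 * n + 20 /\
  15 * wsum mult2 n <= 2 * n ^ 2 + 14 * n + 20.
Proof.
by apply: wsum_bounds; [move=> y; rewrite /mult2 !dvdn_addl | vm_compute | vm_compute].
Qed.

Lemma top_sum N : 847 <= N -> N * (N + 1) <
  4 * \sum_(0 <= y < N.+1 | [|| top5 N y, top3 N y | top2 N y]) y.
Proof.
move=> N847.
have -> : \sum_(0 <= y < N.+1 | [|| top5 N y, top3 N y | top2 N y]) y =
    \sum_(0 <= y < N.+1 | mult5 y && (N %/ 5 < y)) y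
    + \sum_(0 <= y < N.+1 | mult3 y && (3 * N %/ 5 < y)) y
    + \sum_(0 <= y < N.+1 | mult2 y && (2 * N %/ 3 < y)) y.
  (* The divisibility conditions are mutually exclusive, so the three sums add up term by term. *)
  rewrite [LHS]big_mkcond [X in X + _ + _]big_mkcond [X in _ + X + _]big_mkcond.
  rewrite [X in _ + _ + X]big_mkcond -!big_split; apply: eq_bigr => y _.
  rewrite /top5 /top3 /top2 /mult5 /mult3 /mult2 /= !ltn_divLR // !(mulnC y).
  by case: (2 %| y); case: (3 %| y); case: (5 %| y) => //=;
    rewrite ?orbF ?addn0.
(* Sums up to the cutoffs are subtracted, so only upper bounds on [a], [b], [c] matter. *)
have [a aE] : {a | a = N %/ 5} by exists (N %/ 5).
have [b bE] : {b | b = 3 * N %/ 5} by exists (3 * N %/ 5).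
have [c cE] : {c | c = 2 * N %/ 3} by exists (2 * N %/ 3).
rewrite -aE -bE -cE.
have [aN bN cN] : [/\ 5 * a <= N, 5 * b <= 3 * N & 3 * c <= 2 * N] by split; lia.
have t5 : _ = wsum mult5 N := wsum_tail mult5 a N ltac:(lia).
have t3 : _ = wsum mult3 N := wsum_tail mult3 b N ltac:(lia).
have t2 : _ = wsum mult2 N := wsum_tail mult2 c N ltac:(lia).
have [lo5 _] := mult5_bounds N; have [_ up5] := mult5_bounds a.
have [lo3 _] := mult3_bounds N; have [_ up3] := mult3_bounds b.
have [lo2 _] := mult2_bounds N; have [_ up2] := mult2_bounds c.
have a2 : 25 * a ^ 2 <= N ^ 2 by rewrite -(expnMn 5 a 2) leq_sqr.
have b2 : 25 * b ^ 2 <= 9 * N ^ 2.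
  by rewrite -(expnMn 5 b 2) -(expnMn 3 N 2) leq_sqr.
have c2 : 9 * c ^ 2 <= 4 * N ^ 2.
  by rewrite -(expnMn 3 c 2) -(expnMn 2 N 2) leq_sqr.
have NN : 847 * N <= N ^ 2 by rewrite -mulnn leq_mul2r N847 orbT.
have -> : N * (N + 1) = N ^ 2 + N by rewrite mulnDr muln1 mulnn.
(* With squares as atoms the problem is linear. Four times the main term is [(1 + 73/3375) * N ^ 2];
   the excess is at least [18 * N], while all error terms and the [N] on the left total less than
   [12 * N]. *)
move: (N ^ 2) (a ^ 2) (b ^ 2) (c ^ 2) lo5 up5 lo3 up3 lo2 up2 a2 b2 c2 NN.
clear aE bE cE; lia.
Qed.

(* sum_{(x,y) in M} y > (1/2) * N(N+1)/2, cleared of denominators. *)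
Theorem theorem4 (N : nat) (hN : 847 <= N) :
  N * (N + 1) < 4 * (\sum_(e <- born_free_matching N) e.2).
Proof.
apply: leq_trans (top_sum N hN) _; rewrite leq_mul2l /=.
rewrite -(big_map snd xpredT id) -big_filter.
(* Sums are compared as multisets: since the qualifying [y] are listed without repetition, one
   occurrence of each among the larger elements is enough. *)
apply: sub_le_big_seq => [//|x y|y]; first exact: leq_addr.
set L := [seq y <- _ | _].
have uL : uniq L by apply/filter_uniq/iota_uniq.
rewrite count_uniq_mem //; have [yL|//] := boolP (y \in L).
rewrite -has_count has_pred1; move: yL; rewrite mem_filter mem_index_iota.
move=> /andP[Py yb]; apply: top_matched => //; first by lia.
(* The index 0 drops out because every threshold is a strict inequality. *)
move: Py; rewrite /top5 /top3 /top2; lia.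
Qed.
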